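(* There exist constants $c,C>0$ such that the following holds for all $n$ (a multiple of $4$). Let $T=cn^3$, let $|\psi_t\rangle=e^{-iH_{\rm XY}t}|0^n1^n\rangle$, and let $N(z)=\sum_{j=1}^n z_j$. Then $$\frac1T\int_0^T\sum_{z:\,N(z)>n/4}|\langle z|\psi_t\rangle|^2\,dt\;\ge\;\frac14-\frac{C}{\sqrt n}.$$
   Context: $H_{\rm XY}=-\frac12\sum_{w=1}^{2n-1}(X_wX_{w+1}+Y_wY_{w+1})$ acts on $(\mathbb C^2)^{\otimes 2n}$ with computational basis $|z\rangle$, $z\in\{0,1\}^{2n}$ ($X,Y$ Pauli matrices). The left-hand side is the probability of the event $N(z)>n/4$ when $t$ is chosen uniformly in $[0,T]$ and $z$ is obtained by measuring $|\psi_t\rangle$ in the computational basis. (In the paper's circuit-simulation scheme with time-independent Hamiltonian $\sum_pH^p_{\rm prop}$ and initial state $|0^{2n},0^n1^n\rangle_V$, the string register evolves exactly as $|\psi_t\rangle$, and the event $N(z)>n/4$ guarantees that all particles lie outside the $\frac n4\times\frac n4$ interaction region at the left corner of the grid.) *)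

(* Defs.v *)
From Stdlib Require Import Reals List Bool Arith.
Import ListNotations.
Open Scope R_scope.

Record Cx := mkC { Cre : R; Cim : R }.
Definition C0 : Cx := mkC 0 0.
Definition C1 : Cx := mkC 1 0.
Definition Ci : Cx := mkC 0 1.
Definition Cadd (a b : Cx) : Cx := mkC (Cre a + Cre b) (Cim a + Cim b).
Definition Cmul (a b : Cx) : Cx :=
  mkC (Cre a * Cre b - Cim a * Cim b) (Cre a * Cim b + Cim a * Cre b).
Definition Cscal (r : R) (a : Cx) : Cx := mkC (r * Cre a) (r * Cim a).
Definition Copp (a : Cx) : Cx := mkC (- Cre a) (- Cim a).
Fixpoint Cpow (a : Cx) (k : nat) : Cx :=
  match k with O => C1 | S k => Cmul a (Cpow a k) end.
Definition Cnorm2 (a : Cx) : R := Cre a ^ 2 + Cim a ^ 2.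

(** Computational basis strings z in {0,1}^m: lists of booleans
    (false = 0, true = 1); site j (1-indexed) of z is  nth (j-1) z false. *)
Definition bit (z : list bool) (j : nat) : bool := nth (j - 1) z false.

Fixpoint set_nth (z : list bool) (i : nat) (b : bool) : list bool :=
  match z, i with
  | [], _ => []
  | _ :: z', O => b :: z'
  | x :: z', S i' => x :: set_nth z' i' b
  end.

Fixpoint bitstrings (m : nat) : list (list bool) :=
  match m with
  | O => [ [] ]
  | S m' => map (cons false) (bitstrings m') ++ map (cons true) (bitstrings m')
  end.

Definition Vec := list bool -> Cx.
Definition vzero : Vec := fun _ => C0.
Definition vadd (f g : Vec) : Vec := fun z => Cadd (f z) (g z).
Definition vscal (c : Cx) (f : Vec) : Vec := fun z => Cmul c (f z).

(** 2x2 matrices, entries A row col indexed by bits. *)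
Definition Mat2 := bool -> bool -> Cx.
Definition PauliX : Mat2 := fun a b => if Bool.eqb a b then C0 else C1.
Definition PauliY : Mat2 := fun a b =>
  match a, b with
  | false, true => Copp Ci
  | true, false => Ci
  | _, _ => C0
  end.

(** Action of the single-site operator  I ⊗ ... ⊗ A (at site w) ⊗ ... ⊗ I :
    (A_w f)(z) = sum_b A(z_w, b) f(z with site w set to b). *)
Definition op_site (A : Mat2) (w : nat) (f : Vec) : Vec := fun z =>
  Cadd (Cmul (A (bit z w) false) (f (set_nth z (w - 1) false)))
       (Cmul (A (bit z w) true)  (f (set_nth z (w - 1) true))).

Definition H_XY (n : nat) (f : Vec) : Vec :=
  vscal (mkC (-(1/2)) 0)
    (fold_right
       (fun w acc =>
          vadd (vadd (op_site PauliX w (op_site PauliX (w + 1) f))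
                     (op_site PauliY w (op_site PauliY (w + 1) f))) acc)
       vzero (seq 1 (2 * n - 1))).

Fixpoint H_pow (n k : nat) (f : Vec) : Vec :=
  match k with O => f | S k' => H_XY n (H_pow n k' f) end.

Definition init_string (n : nat) : list bool := repeat false n ++ repeat true n.
Definition init_state (n : nat) : Vec := fun z =>
  if list_eq_dec Bool.bool_dec z (init_string n) then C1 else C0.

(** k-th term of the exponential series  e^{-i H t} v = sum_k (-i t)^k/k! H^k v,
    evaluated at basis string z (i.e. <z| applied to it). *)
Definition evo_term (n : nat) (t : R) (z : list bool) (k : nat) : Cx :=
  Cmul (Cscal (/ INR (fact k)) (Cpow (mkC 0 (- t)) k)) (H_pow n k (init_state n) z).

(** amp t z = <z| e^{-i H_XY t} |0^n 1^n>, characterized as the sum of the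
    (convergent) exponential series. *)
Definition is_evolution (n : nat) (amp : R -> list bool -> Cx) : Prop :=
  forall (t : R) (z : list bool), length z = (2 * n)%nat ->
    infinite_sum (fun k => Cre (evo_term n t z k)) (Cre (amp t z)) /\
    infinite_sum (fun k => Cim (evo_term n t z k)) (Cim (amp t z)).

Definition Ncount (n : nat) (z : list bool) : nat :=
  fold_right (fun j acc => (if bit z j then 1 else 0) + acc)%nat 0%nat (seq 1 n).

Definition prob_far (n : nat) (amp : R -> list bool -> Cx) (t : R) : R :=
  fold_right (fun z acc =>
      (if Rlt_dec (INR n / 4) (INR (Ncount n z)) then Cnorm2 (amp t z) else 0) + acc)
    0 (bitstrings (2 * n)).

(* Main.v *)
(* The Jordan-Wigner annihilators a_j satisfy [a_j, H] = -(a_(j-1) + a_(j+1)), so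
   the correlations G_jk = <a_j psi_t, a_k psi_t> evolve by the hopping matrix A
   of the path on 2n sites: the particles are free fermions.  Let S be the
   diagonal matrix with entries -1 on the left half and +1 on the right half.
   The equation [A, K] = 4S (up to sign) is a discrete wave equation with
   Dirichlet conditions, and d'Alembert's formula gives an antisymmetric
   solution K with entries of size at most 2n.  Hence
     4 (E[right] - E[left]) = 4 (n - 2 E[N]) = d/dt (sum_jk K_jk Im G_jk),
   and as |G_jk| <= 1 the right-hand side integrates to O(n^3), whatever T is.
   Thus E[N] has time average n/2 - O(n^3 / T), and since
   E[N] <= n/4 + (3n/4) P(N > n/4), the probability averages to at least
   1/3 - O(n^2 / T). *)
From Stdlib Require Import Reals List Bool Arith Lia Lra ZArith.
From Coquelicot Require Import Coquelicot.
Require Import Defs.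
Import ListNotations.
Open Scope R_scope.

(** * Sums over all strings of a given length *)

(** The fold has the shape used in [prob_far], so that [prob_far] is an instance by conversion. *)
Definition strsum (m : nat) (F : list bool -> R) : R :=
  fold_right (fun z acc => F z + acc) 0 (bitstrings m).

Lemma strsum_0 (F : list bool -> R) : strsum 0 F = F [].
Proof. unfold strsum; simpl; ring. Qed.

Lemma strsum_S (m : nat) (F : list bool -> R) :
  strsum (S m) F
  = strsum m (fun z => F (false :: z)) + strsum m (fun z => F (true :: z)).
Proof.
assert (Hmap : forall b l s,
  fold_right (fun z acc => F z + acc) s (map (cons b) l)
  = fold_right (fun z acc => F (b :: z) + acc) 0 l + s).
{ intros b l s; induction l as [|y l IH]; simpl; [|rewrite IH]; ring. }
unfold strsum; simpl; rewrite fold_right_app, !Hmap; ring.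
Qed.

Lemma strsum_le (m : nat) (F G : list bool -> R) :
  (forall z, length z = m -> F z <= G z) -> strsum m F <= strsum m G.
Proof.
revert F G; induction m as [|m IH]; intros F G H.
- rewrite !strsum_0; apply H; reflexivity.
- rewrite !strsum_S; apply Rplus_le_compat; apply IH; intros z Hz; apply H;
    simpl; lia.
Qed.

Lemma strsum_ext (m : nat) (F G : list bool -> R) :
  (forall z, length z = m -> F z = G z) -> strsum m F = strsum m G.
Proof.
intros H; apply Rle_antisym; apply strsum_le; intros z Hz; rewrite (H z Hz);
  apply Rle_refl.
Qed.

Lemma strsum_plus (m : nat) (F G : list bool -> R) :
  strsum m (fun z => F z + G z) = strsum m F + strsum m G.
Proof.
unfold strsum; induction (bitstrings m) as [|y l IH]; simpl; [|rewrite IH]; ring.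
Qed.

Lemma strsum_scal (m : nat) (c : R) (F : list bool -> R) :
  strsum m (fun z => c * F z) = c * strsum m F.
Proof.
unfold strsum; induction (bitstrings m) as [|y l IH]; simpl; [|rewrite IH]; ring.
Qed.

Lemma strsum_opp (m : nat) (F : list bool -> R) :
  strsum m (fun z => - F z) = - strsum m F.
Proof.
unfold strsum; induction (bitstrings m) as [|y l IH]; simpl; [|rewrite IH]; ring.
Qed.

Lemma strsum_zero (m : nat) (F : list bool -> R) :
  (forall z, length z = m -> F z = 0) -> strsum m F = 0.
Proof.
intros H; rewrite (strsum_ext _ _ (fun z => 0 * F z)), strsum_scal; [ring|].
intros z Hz; rewrite H by assumption; ring.
Qed.

Lemma strsum_sum (m N : nat) (F : nat -> list bool -> R) :
  strsum m (fun z => sum_f_R0 (fun j => F j z) N)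
  = sum_f_R0 (fun j => strsum m (F j)) N.
Proof.
induction N as [|N IH]; simpl; [reflexivity|].
rewrite strsum_plus, IH; reflexivity.
Qed.

Lemma strsum_indicator (m : nat) (z0 : list bool) : length z0 = m ->
  strsum m (fun z => if list_eq_dec Bool.bool_dec z z0 then 1 else 0) = 1.
Proof.
revert z0; induction m as [|m IH]; intros [|b z0] Hz; try discriminate.
- rewrite strsum_0; reflexivity.
- injection Hz as Hz; specialize (IH z0 Hz).
  assert (Hsame : strsum m
    (fun z => if list_eq_dec Bool.bool_dec (b :: z) (b :: z0) then 1 else 0) = 1).
  { rewrite <- IH; apply strsum_ext; intros z _.
    destruct (list_eq_dec bool_dec (b :: z) (b :: z0)),
      (list_eq_dec bool_dec z z0); congruence. }
  assert (Hdiff : forall c, c <> b -> strsum m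
    (fun z => if list_eq_dec Bool.bool_dec (c :: z) (b :: z0) then 1 else 0) = 0).
  { intros c Hc; apply strsum_zero; intros z _.
    destruct (list_eq_dec bool_dec (c :: z) (b :: z0)); congruence. }
  rewrite strsum_S.
  destruct b; rewrite Hsame, Hdiff by discriminate; ring.
Qed.

Lemma is_derive_strsum (m : nat) (F : R -> list bool -> R) (F' : list bool -> R)
  (t : R) : (forall z, is_derive (fun s => F s z) t (F' z)) ->
  is_derive (fun s => strsum m (F s)) t (strsum m F').
Proof.
intros H; unfold strsum; induction (bitstrings m) as [|y l IH]; simpl.
- apply @is_derive_const.
- apply (is_derive_plus (V := R_NormedModule)); [apply H | apply IH].
Qed.

(** * The hopping operator and the fermion annihilators *)

(* Up to sign the XY Hamiltonian, see [H_XY_hop]. *)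
Fixpoint hop (f : list bool -> R) (z : list bool) : R :=
  match z with
  | [] => 0
  | a :: z' =>
      match z' with
      | [] => 0
      | b :: y => if xorb a b then f (b :: a :: y) else 0
      end + hop (fun y => f (a :: y)) z'
  end.

(* The Jordan-Wigner fermion annihilator at the site with 0-based index k. *)
Fixpoint ann (k : nat) (f : list bool -> R) (z : list bool) {struct z} : R :=
  match z with
  | [] => 0
  | b :: z' =>
      match k with
      | O => if b then 0 else f (true :: z')
      | S k' => (if b then -1 else 1) * ann k' (fun y => f (b :: y)) z'
      end
  end.

(* Sites are numbered from 1; site 0 is a Dirichlet boundary. *)
Definition site (j : nat) (f : list bool -> R) (z : list bool) : R :=
  match j with O => 0 | S k => ann k f z end.

Lemma hop_ext (f g : list bool -> R) (z : list bool) :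
  (forall y, length y = length z -> f y = g y) -> hop f z = hop g z.
Proof.
revert f g; induction z as [|a z IH]; intros f g H; simpl; [reflexivity|].
rewrite (IH (fun y => f (a :: y)) (fun y => g (a :: y))).
- destruct z as [|b z]; [reflexivity|].
  rewrite (H (b :: a :: z) eq_refl); reflexivity.
- intros y Hy; apply H; simpl; lia.
Qed.

Lemma hop_scal (c : R) (f : list bool -> R) (z : list bool) :
  hop (fun y => c * f y) z = c * hop f z.
Proof.
revert f; induction z as [|a z IH]; intros f; simpl; [ring|].
rewrite (IH (fun y => f (a :: y))).
destruct z as [|b z]; [ring|]; destruct (xorb a b); ring.
Qed.

Lemma hop_plus (f g : list bool -> R) (z : list bool) :
  hop (fun y => f y + g y) z = hop f z + hop g z.
Proof.
revert f g; induction z as [|a z IH]; intros f g; simpl; [ring|].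
rewrite (IH (fun y => f (a :: y)) (fun y => g (a :: y))).
destruct z as [|b z]; [ring|]; destruct (xorb a b); ring.
Qed.

Lemma ann_plus (k : nat) (f g : list bool -> R) (z : list bool) :
  ann k (fun y => f y + g y) z = ann k f z + ann k g z.
Proof.
revert k f g; induction z as [|a z IH]; intros [|k] f g; simpl; try ring.
- destruct a; ring.
- rewrite (IH k (fun y => f (a :: y)) (fun y => g (a :: y))); ring.
Qed.

Lemma ann_opp (k : nat) (f : list bool -> R) (z : list bool) :
  ann k (fun y => - f y) z = - ann k f z.
Proof.
revert k f; induction z as [|a z IH]; intros [|k] f; simpl; try ring.
- destruct a; ring.
- rewrite (IH k (fun y => f (a :: y))); ring.
Qed.

Lemma ann_zero (k : nat) (z : list bool) : ann k (fun _ => 0) z = 0.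
Proof.
revert k; induction z as [|a z IH]; intros [|k]; simpl; trivial.
- destruct a; reflexivity.
- rewrite IH; ring.
Qed.

(** The commutator of an annihilator with the Hamiltonian, by induction along the string: only the
    two bonds at the site fail to commute with it, and the Jordan-Wigner signs turn each of them
    into a neighbouring annihilator. This makes the fermions free. *)
Lemma site_hop (k : nat) (f : list bool -> R) (z : list bool) :
  (k < length z)%nat ->
  site (S k) (hop f) z
  = hop (site (S k) f) z + site k f z + site (S (S k)) f z.
Proof.
simpl; revert k f; induction z as [|b z IH]; intros k f Hk;
  [inversion Hk|].
destruct k as [|k].
{ destruct z as [|c z]; [destruct b; simpl; ring|].
  replace (hop (site 1 f) (b :: c :: z))
    with ((if xorb b c then ann 0 f (c :: b :: z) else 0)
          + hop (fun y => ann 0 f (b :: y)) (c :: z)) by reflexivity.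
  replace (ann 1 f (b :: c :: z))
    with ((if b then -1 else 1) * (if c then 0 else f (b :: true :: z)))
    by reflexivity.
  replace (ann 0 (hop f) (b :: c :: z))
    with (if b then 0 else (if xorb true c then f (c :: true :: z) else 0)
                           + hop (fun y => f (true :: y)) (c :: z))
    by reflexivity.
  destruct b.
  - rewrite (hop_ext (fun y => ann 0 f (true :: y)) (fun y => 0 * f y))
      by (intros; simpl; ring).
    rewrite hop_scal; destruct c; simpl; ring.
  - change (fun y => ann 0 f (false :: y)) with (fun y => f (true :: y)).
    destruct c; simpl; ring. }
(* [e] is the sign of the first site, [g] the restriction to its bit, and [fst] the contribution of
   the first bond. *)
set (e := if b then -1 else 1).
set (g := fun y => f (b :: y)).
pose (fst := fun y => match y with
              | [] => 0
              | c :: y' => if xorb b c then f (c :: b :: y') else 0 end).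
replace (ann (S k) (hop f) (b :: z))
  with (e * ann k (fun y => fst y + hop g y) z) by reflexivity.
rewrite ann_plus, IH by (simpl in Hk; lia).
replace (hop (site (S (S k)) f) (b :: z))
  with (match z with
        | [] => 0
        | c :: y => if xorb b c then ann (S k) f (c :: b :: y) else 0
        end + hop (fun y => e * ann k g y) z) by (destruct z; reflexivity).
rewrite hop_scal.
replace (ann (S (S k)) f (b :: z)) with (e * ann (S k) g z) by reflexivity.
(* Only the first bond is left. At the second site it produces the term [site 1]; further right it
   commutes with the annihilator, since exchanging two bits keeps the product of their signs. *)
enough (Hloc : e * ann k fst z + e * site k g z =
  match z with
  | [] => 0
  | c :: y => if xorb b c then ann (S k) f (c :: b :: y) else 0
  end + site (S k) f (b :: z)) 
  by (change (hop (site (S k) g) z) with (hop (ann k g) z); lra).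
subst fst; unfold e, g, site; destruct k as [|k].
- destruct z as [|c z]; [simpl in Hk; lia|].
  destruct b, c; simpl; ring.
- destruct z as [|c z]; [simpl in Hk; lia|].
  simpl; destruct (xorb b c); [|rewrite ann_zero]; ring.
Qed.

(** This is the Dirichlet condition at the right end, the counterpart of [site 0]. *)
Lemma site_above (m : nat) (f : list bool -> R) (z : list bool) :
  length z = m -> site (S m) f z = 0.
Proof.
revert m f; induction z as [|a z IH]; intros m f <-; [reflexivity|].
simpl; specialize (IH (length z) (fun y => f (a :: y)) eq_refl).
simpl in IH; rewrite IH; ring.
Qed.

(** * The real inner product and adjoints *)

Definition inner (m : nat) (f g : list bool -> R) : R :=
  strsum m (fun z => f z * g z).

Lemma inner_sym (m : nat) (f g : list bool -> R) : inner m f g = inner m g f.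
Proof. apply strsum_ext; intros; ring. Qed.

Lemma inner_plus_l (m : nat) (f g h : list bool -> R) :
  inner m (fun z => f z + g z) h = inner m f h + inner m g h.
Proof.
unfold inner; rewrite <- strsum_plus; apply strsum_ext; intros; ring.
Qed.

Lemma inner_plus_r (m : nat) (f g h : list bool -> R) :
  inner m h (fun z => f z + g z) = inner m h f + inner m h g.
Proof.
unfold inner; rewrite <- strsum_plus; apply strsum_ext; intros; ring.
Qed.

Lemma inner_opp_l (m : nat) (f g : list bool -> R) :
  inner m (fun z => - f z) g = - inner m f g.
Proof.
unfold inner; rewrite <- strsum_opp; apply strsum_ext; intros; ring.
Qed.

Lemma inner_opp_r (m : nat) (f g : list bool -> R) :
  inner m g (fun z => - f z) = - inner m g f.
Proof.
unfold inner; rewrite <- strsum_opp; apply strsum_ext; intros; ring.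
Qed.

Lemma inner_ext (m : nat) (f f' g g' : list bool -> R) :
  (forall z, length z = m -> f z = f' z) ->
  (forall z, length z = m -> g z = g' z) -> inner m f g = inner m f' g'.
Proof.
intros Hf Hg; apply strsum_ext; intros z Hz; rewrite Hf, Hg by assumption.
reflexivity.
Qed.

Lemma inner_S (m : nat) (f g : list bool -> R) :
  inner (S m) f g
  = inner m (fun z => f (false :: z)) (fun z => g (false :: z))
    + inner m (fun z => f (true :: z)) (fun z => g (true :: z)).
Proof. apply strsum_S. Qed.

(** Each bond term swaps two unequal bits, an involution of the strings, hence symmetric. [fst]
    isolates the first bond for the induction. *)
Lemma hop_sym (m : nat) (f g : list bool -> R) :
  inner m (hop f) g = inner m f (hop g).
Proof.
pose (fst := fun (a : bool) (f : list bool -> R) z => match z with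
              | [] => 0
              | b :: y => if xorb a b then f (b :: a :: y) else 0 end).
revert f g; induction m as [|m IH]; intros f g.
- unfold inner; rewrite !strsum_0; simpl; ring.
- assert (Hfst :
    inner m (fst false f) (fun z => g (false :: z))
    + inner m (fst true f) (fun z => g (true :: z))
    = inner m (fun z => f (false :: z)) (fst false g)
    + inner m (fun z => f (true :: z)) (fst true g)).
  { destruct m as [|m].
    - unfold inner; rewrite !strsum_0; simpl; ring.
    - rewrite !inner_S; unfold fst; simpl.
      unfold inner; rewrite <- !strsum_plus.
      apply strsum_ext; intros; ring. }
  rewrite !inner_S.
  change (fun z => hop f (false :: z))
    with (fun z => fst false f z + hop (fun y => f (false :: y)) z).
  change (fun z => hop f (true :: z))
    with (fun z => fst true f z + hop (fun y => f (true :: y)) z).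
  change (fun z => hop g (false :: z))
    with (fun z => fst false g z + hop (fun y => g (false :: y)) z).
  change (fun z => hop g (true :: z))
    with (fun z => fst true g z + hop (fun y => g (true :: y)) z).
  rewrite !inner_plus_l, !inner_plus_r, !IH; lra.
Qed.

(** The signs square to 1, so the adjoint of the annihilator times the annihilator is the occupation
    number of the site. *)
Lemma inner_ann (m k : nat) (f : list bool -> R) :
  inner m (ann k f) (ann k f)
  = strsum m (fun z => if nth k z false then f z * f z else 0).
Proof.
revert k f; induction m as [|m IH]; intros k f.
- unfold inner; rewrite !strsum_0; destruct k; simpl; ring.
- rewrite inner_S, strsum_S; destruct k as [|k]; simpl.
  + unfold inner; rewrite Rplus_comm; f_equal; apply strsum_ext; intros; ring.
  + rewrite <- !IH; f_equal; apply strsum_ext; intros; ring.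
Qed.

(** * Differentiation and series, term by term *)

Lemma is_derive_ann (k : nat) (u : R -> list bool -> R) (u' : list bool -> R)
  (t : R) (z : list bool) : (forall y, is_derive (fun s => u s y) t (u' y)) ->
  is_derive (fun s => ann k (u s) z) t (ann k u' z).
Proof.
revert k u u'; induction z as [|b z IH]; intros [|k] u u' H; simpl;
  try apply @is_derive_const.
- destruct b; [apply @is_derive_const | apply H].
- apply is_derive_scal.
  apply (IH k (fun s y => u s (b :: y)) (fun y => u' (b :: y))).
  intros y; apply H.
Qed.

Lemma is_series_eq (a b : nat -> R) (l : R) :
  (forall k, a k = b k) -> is_series a l -> is_series b l.
Proof. apply (is_series_ext (V := R_NormedModule)). Qed.

Lemma is_series_zero : is_series (fun _ : nat => 0) 0.
Proof.
apply is_series_Reals; intros eps Heps; exists 0%nat; intros n _.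
rewrite sum_eq_R0 by trivial; unfold Rdist; rewrite Rminus_0_r, Rabs_R0.
exact Heps.
Qed.

Lemma is_series_hop (a : nat -> list bool -> R) (l : list bool -> R)
  (z : list bool) : (forall y, is_series (fun k => a k y) (l y)) ->
  is_series (fun k => hop (a k) z) (hop l z).
Proof.
revert a l; induction z as [|b z IH]; intros a l H; simpl; [apply is_series_zero|].
apply (is_series_plus (V := R_NormedModule)).
- destruct z as [|c z]; [apply is_series_zero|].
  destruct (xorb b c); [apply H | apply is_series_zero].
- apply (IH (fun k y => a k (b :: y)) (fun y => l (b :: y))); intros y; apply H.
Qed.

Lemma is_derive_inner (m : nat) (f g : R -> list bool -> R)
  (f' g' : list bool -> R) (t : R) :
  (forall z, is_derive (fun s => f s z) t (f' z)) ->
  (forall z, is_derive (fun s => g s z) t (g' z)) ->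
  is_derive (fun s => inner m (f s) (g s)) t
    (inner m f' (g t) + inner m (f t) g').
Proof.
intros Hf Hg; unfold inner; rewrite <- strsum_plus.
apply (is_derive_strsum m (fun s z => f s z * g s z)); intros z.
apply (Derive.is_derive_mult (fun s => f s z) (fun s => g s z)); trivial.
Qed.

Lemma is_derive_sum (f : nat -> R -> R) (d : nat -> R) (N : nat) (t : R) :
  (forall k, (k <= N)%nat -> is_derive (f k) t (d k)) ->
  is_derive (fun s => sum_f_R0 (fun k => f k s) N) t (sum_f_R0 d N).
Proof.
intros H; rewrite <- sum_n_Reals.
apply (is_derive_ext (fun s => sum_n (fun k => f k s) N)).
- intros s; apply sum_n_Reals.
- apply (is_derive_sum_n (V := R_NormedModule)); exact H.
Qed.

(** * Finite sums *)

Lemma sum_switch (a : nat -> nat -> R) (M N : nat) :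
  sum_f_R0 (fun j => sum_f_R0 (a j) N) M
  = sum_f_R0 (fun k => sum_f_R0 (fun j => a j k) M) N.
Proof.
induction M as [|M IH]; simpl; [reflexivity|].
rewrite IH, <- plus_sum; reflexivity.
Qed.

(** Since [pred 0 = 0], the product [x 0 * y 0] occurs on both sides and the lower end leaves
    nothing; the upper end leaves a discrete Wronskian, which the hypotheses kill. *)
Lemma sum_by_parts (x y : nat -> R) (N : nat) :
  x N = 0 -> y N = 0 ->
  sum_f_R0 (fun j => x j * (y (pred j) + y (S j))) N
  = sum_f_R0 (fun j => (x (pred j) + x (S j)) * y j) N.
Proof.
assert (H : forall M,
  sum_f_R0 (fun j => x j * (y (pred j) + y (S j))) M
  = sum_f_R0 (fun j => (x (pred j) + x (S j)) * y j) M
    + (x M * y (S M) - x (S M) * y M)).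
{ induction M as [|M IH]; simpl; [|rewrite IH]; simpl; ring. }
intros Hx Hy; rewrite H, Hx, Hy; ring.
Qed.

Lemma sum_single (a : nat -> R) (j N : nat) : (j <= N)%nat ->
  (forall k, (k <= N)%nat -> k <> j -> a k = 0) -> sum_f_R0 a N = a j.
Proof.
intros Hj Ha; induction N as [|N IH]; simpl.
- replace j with 0%nat by lia; reflexivity.
- destruct (Nat.eq_dec j (S N)) as [->|Hne].
  + rewrite sum_eq_R0; [ring|]; intros k Hk; apply Ha; lia.
  + rewrite (Ha (S N)), IH; [ring | lia | | lia | lia].
    intros k Hk; apply Ha; lia.
Qed.

(** * A solution of the discrete wave equation *)

(** A tent of slopes 1 and -1 with zeros at 1 and 4n+1 and peak 2n at 2n+1. *)
Definition wave_profile (n : nat) (d : Z) : Z :=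
  Z.min (d - 1) (4 * Z.of_nat n + 1 - d).

(* The d'Alembert solution of the discrete wave equation [kernel_wave], with
   Dirichlet conditions at the sites 0 and 2n+1: in matrix terms, its
   commutator with the hopping matrix of the path is diagonal. *)
Definition kernel (n j k : nat) : Z :=
  if Nat.even (j + k) then 0%Z
  else if (j <? k)%nat
  then (wave_profile n (Z.of_nat k - Z.of_nat j)
        - wave_profile n (Z.of_nat k + Z.of_nat j))%Z
  else (wave_profile n (Z.of_nat k + Z.of_nat j)
        - wave_profile n (Z.of_nat j - Z.of_nat k))%Z.

Definition side (n j : nat) : Z := if (j <=? n)%nat then (-4)%Z else 4%Z.

(** Off the diagonal, functions of k-j and of k+j solve the wave equation. On the diagonal, with W
    the profile, the left side is 2(W(2j-1) - W(2j+1)): the two slopes of the tent give -4 and 4,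
    with the change just after j = n. If j+k is odd, all four entries vanish by parity. *)
Lemma kernel_wave (n j k : nat) :
  (1 <= j <= 2 * n)%nat -> (1 <= k <= 2 * n)%nat ->
  (kernel n j (pred k) + kernel n j (S k) - kernel n (pred j) k
   - kernel n (S j) k)%Z = if (j =? k)%nat then side n j else 0%Z.
Proof.
intros Hj Hk; destruct j as [|j], k as [|k]; try lia.
unfold kernel, side, wave_profile; cbn [Nat.pred].
replace (S j + S (S k))%nat with (S (S (S (j + k)))) by lia.
replace (S (S j) + S k)%nat with (S (S (S (j + k)))) by lia.
replace (j + S k)%nat with (S (j + k)) by lia.
replace (S j + k)%nat with (S (j + k)) by lia.
change (Nat.even (S (S (S (j + k))))) with (Nat.even (S (j + k))).
destruct (Nat.even (S (j + k))) eqn:E.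
- destruct (Nat.eqb_spec (S j) (S k)); [|lia].
  apply Nat.even_spec in E; destruct E as [p Hp]; lia.
- rewrite <- Nat.negb_odd, negb_false_iff in E.
  apply Nat.odd_spec in E; destruct E as [p Hp].
  destruct (Nat.eqb_spec (S j) (S k)), (Nat.leb_spec (S j) n),
    (Nat.ltb_spec (S j) k), (Nat.ltb_spec (S j) (S (S k))),
    (Nat.ltb_spec j (S k)), (Nat.ltb_spec (S (S j)) (S k)); lia.
Qed.

(** At the odd arguments that occur, between 1 and 4n+1, the profile lies between 0 and 2n. *)
Lemma kernel_bound (n j k : nat) :
  (j <= S (2 * n))%nat -> (k <= S (2 * n))%nat ->
  (Z.abs (kernel n j k) <= 2 * Z.of_nat n)%Z.
Proof.
intros Hj Hk; unfold kernel, wave_profile.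
destruct (Nat.even (j + k)) eqn:E; [lia|].
rewrite <- Nat.negb_odd, negb_false_iff in E.
apply Nat.odd_spec in E; destruct E as [p Hp].
destruct (Nat.ltb_spec j k); lia.
Qed.

(** The tent is symmetric about 2n+1, so the two profile values coincide. *)
Lemma kernel_boundary (n j k : nat) :
  (j <= S (2 * n))%nat -> (k <= S (2 * n))%nat ->
  j = S (2 * n) \/ k = S (2 * n) -> kernel n j k = 0%Z.
Proof.
intros Hj Hk Hb; unfold kernel, wave_profile.
destruct (Nat.even (j + k)) eqn:E; [reflexivity|].
destruct (Nat.ltb_spec j k); lia.
Qed.

Lemma kernel_boundary0 (n j k : nat) :
  j = 0%nat \/ k = 0%nat -> kernel n j k = 0%Z.
Proof.
intros Hb; unfold kernel, wave_profile.
destruct (Nat.even (j + k)) eqn:E; [reflexivity|].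
destruct (Nat.ltb_spec j k); lia.
Qed.

(** Summation by parts in each index moves the commutator with the hopping matrix from [D] to the
    kernel, where [kernel_wave] leaves only the diagonal. The rows and columns at both ends vanish
    in [D], so the wave equation is used at interior sites only. *)
Lemma kernel_sum (n : nat) (D : nat -> nat -> R) :
  (forall k, D 0%nat k = 0) -> (forall j, D j 0%nat = 0) ->
  (forall k, D (S (2 * n)) k = 0) -> (forall j, D j (S (2 * n)) = 0) ->
  sum_f_R0 (fun j => sum_f_R0 (fun k => IZR (kernel n j k) *
    (D j (pred k) + D j (S k) - D (pred j) k - D (S j) k))
    (S (2 * n))) (S (2 * n))
  = sum_f_R0 (fun j => IZR (side n j) * D j j) (S (2 * n)).
Proof.
intros H0l H0r H1l H1r; set (N := S (2 * n)) in *.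
set (K := fun j k => IZR (kernel n j k)).
transitivity (sum_f_R0 (fun j => sum_f_R0 (fun k =>
  (K j (pred k) + K j (S k) - K (pred j) k - K (S j) k) * D j k) N) N).
- transitivity (
    sum_f_R0 (fun j =>
      sum_f_R0 (fun k => K j k * (D j (pred k) + D j (S k))) N) N
    - sum_f_R0 (fun k =>
      sum_f_R0 (fun j => K j k * (D (pred j) k + D (S j) k)) N) N).
  { rewrite (sum_switch (fun k j => K j k * (D (pred j) k + D (S j) k))).
    rewrite <- minus_sum; apply sum_eq; intros j _.
    rewrite <- minus_sum; apply sum_eq; intros k _; unfold K; ring. }
  transitivity (
    sum_f_R0 (fun j =>
      sum_f_R0 (fun k => (K j (pred k) + K j (S k)) * D j k) N) N
    - sum_f_R0 (fun k =>
      sum_f_R0 (fun j => (K (pred j) k + K (S j) k) * D j k) N) N).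
  { f_equal; apply sum_eq; intros i Hi.
    - apply (sum_by_parts (K i) (D i)); [|apply H1r].
      unfold K; rewrite kernel_boundary by (unfold N in *; lia); reflexivity.
    - apply (sum_by_parts (fun j => K j i) (fun j => D j i)); [|apply H1l].
      unfold K; rewrite kernel_boundary by (unfold N in *; lia); reflexivity. }
  rewrite (sum_switch (fun k j => (K (pred j) k + K (S j) k) * D j k)).
  rewrite <- minus_sum; apply sum_eq; intros j _.
  rewrite <- minus_sum; apply sum_eq; intros k _; ring.
- apply sum_eq; intros j Hj.
  assert (HW : forall k, (k <= N)%nat ->
    (K j (pred k) + K j (S k) - K (pred j) k - K (S j) k) * D j k
    = (if (j =? k)%nat then IZR (side n j) else 0) * D j k).
  { intros k Hk.
    destruct (Nat.eq_dec j 0) as [->|]; [rewrite H0l; ring|].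
    destruct (Nat.eq_dec k 0) as [->|]; [rewrite H0r; ring|].
    destruct (Nat.eq_dec j N) as [->|]; [rewrite H1l; ring|].
    destruct (Nat.eq_dec k N) as [->|]; [rewrite H1r; ring|].
    unfold K; rewrite <- plus_IZR, <- !minus_IZR, kernel_wave
      by (unfold N in *; lia).
    destruct (j =? k)%nat; reflexivity. }
  rewrite (sum_single _ j N Hj).
  + rewrite HW, Nat.eqb_refl by exact Hj; reflexivity.
  + intros k Hk Hne; rewrite HW by exact Hk.
    destruct (Nat.eqb_spec j k); [congruence | ring].
Qed.

(** * Equations of motion of the correlations *)

(* Real and imaginary parts of the one-particle correlation matrix
   <a_j psi, a_k psi> of psi = u + i v. *)
Definition corr_re (m j k : nat) (u v : list bool -> R) : R :=
  inner m (site j u) (site k u) + inner m (site j v) (site k v).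
Definition corr_im (m j k : nat) (u v : list bool -> R) : R :=
  inner m (site j u) (site k v) - inner m (site j v) (site k u).

Definition current (n : nat) (u v : list bool -> R) : R :=
  sum_f_R0 (fun j => sum_f_R0 (fun k =>
    IZR (kernel n j k) * corr_im (2 * n) j k u v) (S (2 * n))) (S (2 * n)).

Lemma is_derive_site (j : nat) (u : R -> list bool -> R) (u' : list bool -> R)
  (t : R) : (forall y, is_derive (fun s => u s y) t (u' y)) ->
  forall z, is_derive (fun s => site j (u s) z) t (site j u' z).
Proof.
intros H z; destruct j as [|j]; simpl; [apply @is_derive_const|].
apply is_derive_ann; exact H.
Qed.

(* psi' = -i H psi, with H = - hop and psi = u + i v. *)
Definition schroedinger (u v : R -> list bool -> R) : Prop :=
  (forall t z, is_derive (fun s => u s z) t (- hop (v t) z)) /\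
  (forall t z, is_derive (fun s => v s z) t (hop (u t) z)).

(** Commuting the annihilators past [hop] yields the neighbouring correlations; the remaining terms,
    with [hop] outside the annihilators, cancel because [hop] is symmetric. *)
Lemma corr_im_derive (m j k : nat) (u v : R -> list bool -> R) (t : R) :
  schroedinger u v -> (1 <= j <= m)%nat -> (1 <= k <= m)%nat ->
  is_derive (fun s => corr_im m j k (u s) (v s)) t
    (corr_re m j (pred k) (u t) (v t) + corr_re m j (S k) (u t) (v t)
     - corr_re m (pred j) k (u t) (v t) - corr_re m (S j) k (u t) (v t)).
Proof.
intros [Hu Hv] Hj Hk; destruct j as [|j], k as [|k]; try lia.
assert (Hl : forall i f g, (i < m)%nat ->
  inner m (site (S i) (hop f)) g = inner m (hop (site (S i) f)) g
    + inner m (site i f) g + inner m (site (S (S i)) f) g).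
{ intros i f g Hi; rewrite <- !inner_plus_l.
  apply inner_ext; [|trivial]; intros z Hz; apply site_hop; lia. }
assert (Hopp : forall i f z,
  site (S i) (fun y => - hop f y) z = - site (S i) (hop f) z)
  by (intros; apply ann_opp).
set (a := u t) in *; set (b := v t) in *.
replace (_ - _) with
  ((inner m (site (S j) (fun z => - hop b z)) (site (S k) b)
    + inner m (site (S j) a) (site (S k) (hop a)))
   - (inner m (site (S j) (hop a)) (site (S k) a)
      + inner m (site (S j) b) (site (S k) (fun z => - hop b z)))).
- apply (is_derive_minus (V := R_NormedModule)); apply is_derive_inner;
    apply is_derive_site; intros y; unfold a, b; auto.
- rewrite (inner_ext _ (site (S j) (fun z => - hop b z))
    (fun z => - site (S j) (hop b) z) (site (S k) b) (site (S k) b)),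
    inner_opp_l by (intros; auto).
  rewrite (inner_ext _ (site (S j) b) (site (S j) b)
    (site (S k) (fun z => - hop b z)) (fun z => - site (S k) (hop b) z)),
    inner_opp_r by (intros; auto).
  rewrite (inner_sym m (site (S j) a) (site (S k) (hop a))),
    (inner_sym m (site (S j) b) (site (S k) (hop b))).
  rewrite !Hl by lia; rewrite !hop_sym.
  unfold corr_re; cbn [Nat.pred].
  rewrite (inner_sym m (site (S k) a) (hop (site (S j) a))), hop_sym.
  rewrite (inner_sym m (site (S k) b) (hop (site (S j) b))), hop_sym.
  rewrite (inner_sym m (site k a)), (inner_sym m (site k b)),
    (inner_sym m (site (S (S k)) a)), (inner_sym m (site (S (S k)) b)).
  ring.
Qed.

Lemma ex_derive_corr_re (m j k : nat) (u v : R -> list bool -> R) (t : R) :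
  schroedinger u v -> ex_derive (fun s => corr_re m j k (u s) (v s)) t.
Proof.
intros [Hu Hv].
assert (Hsu := fun i => is_derive_site i u _ t (Hu t)).
assert (Hsv := fun i => is_derive_site i v _ t (Hv t)).
exact (ex_intro _ _ (is_derive_plus (V := R_NormedModule) _ _ _ _ _
  (is_derive_inner m _ _ _ _ t (Hsu j) (Hsu k))
  (is_derive_inner m _ _ _ _ t (Hsv j) (Hsv k)))).
Qed.

(** The derivatives of the imaginary parts form a commutator of the real parts with the hopping
    matrix, and [kernel_sum] reduces its pairing with the kernel to the diagonal. *)
Lemma current_derive (n : nat) (u v : R -> list bool -> R) (t : R) :
  schroedinger u v ->
  is_derive (fun s => current n (u s) (v s)) t
    (sum_f_R0 (fun j => IZR (side n j) * corr_re (2 * n) j j (u t) (v t))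
       (S (2 * n))).
Proof.
intros HS.
rewrite <- (kernel_sum n (fun j k => corr_re (2 * n) j k (u t) (v t))).
- apply (is_derive_sum (fun j s => sum_f_R0 (fun k =>
    IZR (kernel n j k) * corr_im (2 * n) j k (u s) (v s)) (S (2 * n)))).
  intros j Hj.
  apply (is_derive_sum (fun k s =>
    IZR (kernel n j k) * corr_im (2 * n) j k (u s) (v s))).
  intros k Hk.
  (* [corr_im_derive] needs interior sites; a nonzero kernel entry guarantees them. *)
  destruct (Z.eq_dec (kernel n j k) 0) as [H0|H0].
  + rewrite H0, Rmult_0_l.
    apply (is_derive_ext (fun _ => 0)); [|apply @is_derive_const].
    intros s; symmetry; apply Rmult_0_l.
  + apply is_derive_scal, corr_im_derive; trivial; split;
      try (destruct (Nat.eq_dec j 0), (Nat.eq_dec k 0);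
           try (contradict H0; apply kernel_boundary0; lia); lia);
      destruct (Nat.eq_dec j (S (2 * n))), (Nat.eq_dec k (S (2 * n)));
      try (contradict H0; apply kernel_boundary; lia); lia.
- intros k; unfold corr_re, inner.
  rewrite !strsum_zero by (intros; simpl; ring); ring.
- intros j; unfold corr_re, inner.
  rewrite !strsum_zero by (intros; simpl; ring); ring.
- intros k; unfold corr_re, inner.
  rewrite !strsum_zero by (intros; rewrite site_above by assumption; ring); ring.
- intros j; unfold corr_re, inner.
  rewrite !strsum_zero by (intros; rewrite (site_above (2 * n)) by assumption; ring).
  ring.
Qed.

(** * Bounds, and conservation of the norm *)

Definition norm2 (m : nat) (u v : list bool -> R) : R := inner m u u + inner m v v.

Lemma inner_nonneg (m : nat) (f : list bool -> R) : 0 <= inner m f f.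
Proof.
unfold inner; rewrite <- (strsum_zero m (fun _ => 0)) by trivial.
apply strsum_le; intros; nra.
Qed.

(** Expand the squared norms of f+g and f-g. *)
Lemma inner_bound (m : nat) (f g : list bool -> R) :
  Rabs (inner m f g) <= (inner m f f + inner m g g) / 2.
Proof.
assert (H1 := inner_nonneg m (fun z => f z + g z)).
assert (H2 := inner_nonneg m (fun z => f z + - g z)).
rewrite inner_plus_l, !inner_plus_r, (inner_sym m g f) in H1.
rewrite inner_plus_l, !inner_plus_r, !inner_opp_l, !inner_opp_r,
  (inner_sym m g f) in H2.
apply Rabs_le; lra.
Qed.

Lemma inner_site_le (m j : nat) (f : list bool -> R) :
  inner m (site j f) (site j f) <= inner m f f.
Proof.
destruct j as [|j].
- unfold inner at 1; simpl.
  rewrite strsum_zero by (intros; ring); apply inner_nonneg.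
- change (site (S j) f) with (ann j f); rewrite inner_ann.
  apply strsum_le; intros z _.
  destruct (nth j z false); nra.
Qed.

Lemma corr_im_bound (m j k : nat) (u v : list bool -> R) :
  Rabs (corr_im m j k u v) <= norm2 m u v.
Proof.
unfold corr_im, norm2.
assert (H1 := inner_bound m (site j u) (site k v)).
assert (H2 := inner_bound m (site j v) (site k u)).
assert (H3 := inner_site_le m j u); assert (H4 := inner_site_le m j v).
assert (H5 := inner_site_le m k u); assert (H6 := inner_site_le m k v).
apply Rabs_le_between in H1; apply Rabs_le_between in H2.
apply Rabs_le; lra.
Qed.

Lemma sum_abs_le (a : nat -> R) (N : nat) (B : R) :
  (forall k, (k <= N)%nat -> Rabs (a k) <= B) ->
  Rabs (sum_f_R0 a N) <= INR (S N) * B.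
Proof.
intros H; apply (Rle_trans _ _ _ (Rsum_abs a N)).
apply (Rle_trans _ _ _ (sum_Rle _ (fun _ => B) N H)).
rewrite sum_cte; lra.
Qed.

Lemma current_bound (n : nat) (u v : list bool -> R) :
  norm2 (2 * n) u v = 1 ->
  Rabs (current n u v) <= 2 * INR n * (2 * INR n + 2) ^ 2.
Proof.
intros Hn.
(* Each index takes 2n+2 values, a kernel entry is at most 2n, and a correlation at most 1. *)
replace (2 * INR n * (2 * INR n + 2) ^ 2)
  with (INR (S (S (2 * n))) * (INR (S (S (2 * n))) * (2 * INR n * 1)))
  by (rewrite !S_INR, mult_INR; simpl; ring).
apply sum_abs_le; intros j Hj; apply sum_abs_le; intros k Hk.
rewrite Rabs_mult; apply Rmult_le_compat; try apply Rabs_pos.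
- rewrite INR_IZR_INZ, <- mult_IZR, <- abs_IZR.
  apply IZR_le, kernel_bound; assumption.
- rewrite <- Hn; apply corr_im_bound.
Qed.

Lemma norm2_derive (m : nat) (u v : R -> list bool -> R) (t : R) :
  schroedinger u v -> is_derive (fun s => norm2 m (u s) (v s)) t 0.
Proof.
intros [Hu Hv].
replace 0 with
  ((inner m (fun z => - hop (v t) z) (u t)
    + inner m (u t) (fun z => - hop (v t) z))
   + (inner m (hop (u t)) (v t) + inner m (v t) (hop (u t)))).
- apply (is_derive_plus (V := R_NormedModule)); apply is_derive_inner; auto.
- rewrite inner_opp_l, inner_opp_r, !(hop_sym m (v t)),
    (inner_sym m (hop (u t))), (inner_sym m (u t)), hop_sym.
  rewrite (inner_sym m (v t) (hop (u t))), hop_sym; ring.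
Qed.

(** * Particle numbers and the imbalance of the two halves *)

Lemma Ncount_S (m : nat) (z : list bool) :
  Ncount (S m) z = (Ncount m z + if bit z (S m) then 1 else 0)%nat.
Proof.
assert (H : forall l s,
  fold_right (fun j acc => (if bit z j then 1 else 0) + acc)%nat s l
  = (fold_right (fun j acc => (if bit z j then 1 else 0) + acc) 0 l + s)%nat).
{ intros l s; induction l as [|j l IH]; cbn [fold_right]; [|rewrite IH]; lia. }
unfold Ncount; rewrite seq_S, fold_right_app, H; simpl; lia.
Qed.

Lemma Ncount_cons (m : nat) (b : bool) (z : list bool) :
  Ncount (S m) (b :: z) = ((if b then 1 else 0) + Ncount m z)%nat.
Proof.
induction m as [|m IH]; [reflexivity|].
rewrite Ncount_S, IH, (Ncount_S m z).
replace (bit (b :: z) (S (S m))) with (bit z (S m))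
  by (unfold bit; simpl; rewrite Nat.sub_0_r; reflexivity).
lia.
Qed.

(** Positions beyond the end of the string read the default [false]. This lets the sums run up to
    the boundary site 2n+1. *)
Lemma Ncount_all (m : nat) (z : list bool) : (length z <= m)%nat ->
  Ncount m z = count_occ Bool.bool_dec z true.
Proof.
revert m; induction z as [|b z IH]; intros m Hm.
- clear Hm; induction m as [|m IH]; [reflexivity|].
  rewrite Ncount_S, IH; unfold bit; destruct (S m - 1)%nat; reflexivity.
- simpl in Hm; destruct m as [|m]; [lia|].
  rewrite Ncount_cons, IH by lia; destruct b; reflexivity.
Qed.

Lemma Ncount_le (m : nat) (z : list bool) : (Ncount m z <= m)%nat.
Proof.
induction m as [|m IH]; [apply le_n|].
rewrite Ncount_S; destruct (bit z (S m)); lia.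
Qed.

(** Site 0 is set apart because truncated subtraction makes [bit z 0] read the first bit. *)
Definition occupation (j : nat) (z : list bool) : R :=
  match j with O => 0 | S _ => if bit z j then 1 else 0 end.

(** Weight 4 on the right and -4 on the left is 4 times everything minus 8 times the left; the
    minimum freezes the left count once [m] passes [n]. *)
Lemma side_sum (n m : nat) (z : list bool) :
  sum_f_R0 (fun j => IZR (side n j) * occupation j z) m
  = 4 * INR (Ncount m z) - 8 * INR (Ncount (Nat.min m n) z).
Proof.
induction m as [|m IH]; [simpl; ring|].
rewrite tech5, IH; unfold occupation, side.
destruct (Nat.leb_spec (S m) n).
- rewrite !Nat.min_l by lia; rewrite Ncount_S, plus_INR.
  destruct (bit z (S m)); simpl; ring.
- rewrite !Nat.min_r by lia; rewrite (Ncount_S m), plus_INR.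
  destruct (bit z (S m)); simpl; ring.
Qed.

Lemma corr_re_diag (m j : nat) (u v : list bool -> R) :
  corr_re m j j u v
  = strsum m (fun z => occupation j z * (u z * u z + v z * v z)).
Proof.
unfold corr_re; destruct j as [|j].
- unfold inner; rewrite !strsum_zero by (intros; simpl; ring); ring.
- change (site (S j)) with (ann j); rewrite !inner_ann, <- strsum_plus.
  apply strsum_ext; intros z _; unfold occupation, bit.
  rewrite Nat.sub_succ, Nat.sub_0_r; destruct (nth j z false); ring.
Qed.

Lemma current_rate (n : nat) (u v : list bool -> R) :
  sum_f_R0 (fun j => IZR (side n j) * corr_re (2 * n) j j u v) (S (2 * n))
  = strsum (2 * n) (fun z =>
      (4 * INR (count_occ Bool.bool_dec z true) - 8 * INR (Ncount n z))
      * (u z * u z + v z * v z)).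
Proof.
transitivity (sum_f_R0 (fun j => strsum (2 * n) (fun z =>
  IZR (side n j) * occupation j z * (u z * u z + v z * v z))) (S (2 * n))).
- apply sum_eq; intros j _; rewrite corr_re_diag, <- strsum_scal.
  apply strsum_ext; intros; ring.
- rewrite <- strsum_sum; apply strsum_ext; intros z Hz.
  rewrite <- (Ncount_all (S (2 * n))) by lia.
  assert (Hside := side_sum n (S (2 * n)) z).
  rewrite Nat.min_r in Hside by lia.
  rewrite <- Hside, (Rmult_comm _ (u z * u z + v z * v z)), scal_sum.
  apply sum_eq; intros; ring.
Qed.

(** Hopping conserves the number of particles; [c] counts those in the prefix already stripped by
    the induction. *)
Lemma hop_support (c w : nat) (f : list bool -> R) (z : list bool) :
  (forall y, (c + count_occ Bool.bool_dec y true)%nat <> w -> f y = 0) ->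
  (c + count_occ Bool.bool_dec z true)%nat <> w -> hop f z = 0.
Proof.
revert c f; induction z as [|a z IH]; intros c f Hf Hz; [reflexivity|].
simpl hop; rewrite (IH (c + if a then 1 else 0)%nat (fun y => f (a :: y))).
- destruct z as [|b z]; [ring|].
  rewrite Hf; [destruct (xorb a b); ring|].
  destruct a, b; simpl in Hz |- *; lia.
- intros y Hy; apply Hf; destruct a; simpl; lia.
- destruct a; simpl in Hz |- *; lia.
Qed.

(** * The XY Hamiltonian as a hopping operator *)

Definition bond (w : nat) (f : Vec) : Vec :=
  vadd (op_site PauliX w (op_site PauliX (w + 1) f))
       (op_site PauliY w (op_site PauliY (w + 1) f)).

(** XX and YY cancel on equal bits and add up on unequal ones, giving twice the swap. This 2 is
    absorbed by the factor -1/2 of [H_XY]. *)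
Lemma bond_head (f : Vec) (a b : bool) (z : list bool) :
  bond 1 f (a :: b :: z)
  = if xorb a b then Cscal 2 (f (b :: a :: z)) else Defs.C0.
Proof.
destruct a, b; unfold bond, vadd, op_site; simpl;
  unfold Cadd, Cmul, Cscal, Defs.Copp, Defs.C0, Defs.C1, Defs.Ci; simpl;
  f_equal; ring.
Qed.

Lemma bond_tail (w : nat) (f : Vec) (a : bool) (z : list bool) :
  bond (S (S w)) f (a :: z) = bond (S w) (fun y => f (a :: y)) z.
Proof.
unfold bond, vadd, op_site, bit; rewrite !Nat.add_1_r; simpl.
rewrite !Nat.sub_0_r; reflexivity.
Qed.

Lemma bonds_hop (m : nat) (f : Vec) (z : list bool) : length z = S m ->
  fold_right (fun w acc => vadd (bond w f) acc) vzero (seq 1 m) z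
  = mkC (2 * hop (fun y => Cre (f y)) z) (2 * hop (fun y => Cim (f y)) z).
Proof.
assert (Hvadd : forall p q x, vadd p q x = Cadd (p x) (q x)) by reflexivity.
assert (Htail : forall l g a y,
  fold_right (fun w acc => vadd (bond w g) acc) vzero (map S (map S l)) (a :: y)
  = fold_right (fun w acc => vadd (bond w (fun x => g (a :: x))) acc)
      vzero (map S l) y).
{ intros l g a y; induction l as [|w l IH]; [reflexivity|].
  cbn [map fold_right]; rewrite !Hvadd, IH, bond_tail; reflexivity. }
revert f z; induction m as [|m IH]; intros f [|a z] Hz; try discriminate.
- destruct z; [|discriminate]; simpl; unfold vzero, Defs.C0; f_equal; ring.
- destruct z as [|b z]; [discriminate|].
  assert (Hz' : length (b :: z) = S m) by (simpl in Hz |- *; lia).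
  rewrite <- cons_seq, <- seq_shift, <- (seq_shift m 0).
  cbn [fold_right]; rewrite Hvadd, Htail, seq_shift, IH, bond_head
    by exact Hz'.
  change (hop ?g (a :: b :: z)) with
    ((if xorb a b then g (b :: a :: z) else 0)
     + hop (fun y => g (a :: y)) (b :: z)).
  destruct (xorb a b); unfold Cadd, Cscal, Defs.C0; cbn [Cre Cim]; f_equal; ring.
Qed.

Lemma H_XY_hop (n : nat) (f : Vec) (z : list bool) :
  (0 < n)%nat -> length z = (2 * n)%nat ->
  H_XY n f z
  = mkC (- hop (fun y => Cre (f y)) z) (- hop (fun y => Cim (f y)) z).
Proof.
intros Hn Hz; unfold H_XY, vscal.
change (fun w acc => vadd (vadd _ _) acc)
  with (fun w acc => vadd (bond w f) acc).
rewrite bonds_hop by lia; unfold Cmul; cbn [Cre Cim]; f_equal; field.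
Qed.

(** * From the exponential series to the Schroedinger equation *)

(** The Taylor coefficients in [t]. They are 0 on strings of the wrong length, where [is_evolution]
    says nothing, so that the identities below hold for every string. *)
Definition evo_coeff (n k : nat) (z : list bool) : Cx :=
  if (length z =? 2 * n)%nat
  then Cmul (Cscal (/ INR (fact k)) (Cpow (mkC 0 (-1)) k))
         (H_pow n k (init_state n) z)
  else Defs.C0.

Lemma evo_term_coeff (n k : nat) (t : R) (z : list bool) :
  length z = (2 * n)%nat ->
  Cre (evo_term n t z k) = Cre (evo_coeff n k z) * t ^ k /\
  Cim (evo_term n t z k) = Cim (evo_coeff n k z) * t ^ k.
Proof.
intros Hz; unfold evo_term, evo_coeff; rewrite Hz, Nat.eqb_refl.
assert (Hpow : Cpow (mkC 0 (- t)) k = Cscal (t ^ k) (Cpow (mkC 0 (-1)) k)).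
{ induction k as [|k IH]; simpl; [unfold Cscal, Defs.C1; simpl; f_equal; ring|].
  rewrite IH; unfold Cmul, Cscal; simpl; f_equal; ring. }
rewrite Hpow; unfold Cmul, Cscal; cbn [Cre Cim]; split; ring.
Qed.

(** The recursion (k+1) c_(k+1) = -i H c_k = i hop c_k, split into real and imaginary parts. *)
Lemma evo_coeff_S (n k : nat) (z : list bool) : (0 < n)%nat ->
  INR (S k) * Cre (evo_coeff n (S k) z)
    = - hop (fun y => Cim (evo_coeff n k y)) z /\
  INR (S k) * Cim (evo_coeff n (S k) z)
    = hop (fun y => Cre (evo_coeff n k y)) z.
Proof.
intros Hn.
destruct (Nat.eqb_spec (length z) (2 * n)) as [Hz|Hz].
- assert (Hk : INR (fact k) <> 0) by apply INR_fact_neq_0.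
  assert (HSk : INR (S k) <> 0) by (apply not_0_INR; lia).
  set (h := H_pow n k (init_state n)).
  set (w := Cpow (mkC 0 (-1)) k).
  assert (Hlin : forall a b, hop (fun y => a * Cre (h y) + b * Cim (h y)) z
    = a * hop (fun y => Cre (h y)) z + b * hop (fun y => Cim (h y)) z).
  { intros a b; rewrite <- !hop_scal; apply hop_plus. }
  rewrite (hop_ext (fun y => Cim (evo_coeff n k y))
    (fun y => (/ INR (fact k) * Cim w) * Cre (h y)
              + (/ INR (fact k) * Cre w) * Cim (h y))).
  2: { intros y Hy; unfold evo_coeff; rewrite Hy, Hz, Nat.eqb_refl.
       unfold Cmul, Cscal; cbn [Cre Cim]; fold h w; ring. }
  rewrite (hop_ext (fun y => Cre (evo_coeff n k y))
    (fun y => (/ INR (fact k) * Cre w) * Cre (h y)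
              + (- / INR (fact k) * Cim w) * Cim (h y))).
  2: { intros y Hy; unfold evo_coeff; rewrite Hy, Hz, Nat.eqb_refl.
       unfold Cmul, Cscal; cbn [Cre Cim]; fold h w; ring. }
  rewrite !Hlin; unfold evo_coeff; rewrite Hz, Nat.eqb_refl.
  cbn [H_pow Cpow]; rewrite H_XY_hop by assumption.
  rewrite fact_simpl, mult_INR; unfold Cmul, Cscal; cbn [Cre Cim]; fold h w.
  split; field; split; assumption.
(* On a string of the wrong length [hop] sees only strings of that same length, so both sides are
   0. *)
- assert (H0 : forall f : Cx -> R, f Defs.C0 = 0 ->
    hop (fun y => f (evo_coeff n k y)) z = 0).
  { intros f Hf; rewrite (hop_ext _ (fun _ => 0 * 0)), hop_scal; [ring|].
    intros y Hy; unfold evo_coeff.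
    destruct (Nat.eqb_spec (length y) (2 * n)); [congruence|]; rewrite Hf; ring. }
  rewrite !H0 by reflexivity; unfold evo_coeff.
  destruct (Nat.eqb_spec (length z) (2 * n)); [contradiction|].
  simpl; split; ring.
Qed.

Lemma evo_coeff_support (n k : nat) (z : list bool) : (0 < n)%nat ->
  count_occ Bool.bool_dec z true <> n ->
  Cre (evo_coeff n k z) = 0 /\ Cim (evo_coeff n k z) = 0.
Proof.
intros Hn; revert z; induction k as [|k IH]; intros z Hz.
- unfold evo_coeff; destruct (Nat.eqb_spec (length z) (2 * n)); [|split; reflexivity].
  simpl; unfold init_state.
  destruct (list_eq_dec bool_dec z (init_string n)) as [->|];
    [|simpl; split; ring].
  contradict Hz; unfold init_string; rewrite count_occ_app,
    count_occ_repeat_neq, count_occ_repeat_eq by congruence; reflexivity.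
- destruct (evo_coeff_S n k z Hn) as [Hre Him].
  rewrite (hop_support 0 n) in Hre, Him; try assumption;
    try (intros y Hy; apply IH; exact Hy).
  assert (HSk : INR (S k) <> 0) by (apply not_0_INR; lia).
  split; apply (Rmult_eq_reg_l (INR (S k))); trivial; lra.
Qed.

Lemma power_series_derive (a : nat -> R) (f : R -> R) (t l : R) :
  (forall s, is_series (fun k => a k * s ^ k) (f s)) ->
  is_series (fun k => INR (S k) * a (S k) * t ^ k) l ->
  is_derive f t l.
Proof.
intros Hf Hl.
assert (Hps : forall s, PSeries a s = f s)
  by (intros s; apply is_pseries_unique, is_pseries_R, Hf).
(* Were the radius at most |t|, the terms at |t|+1 could not tend to 0, although the series
   converges there. *)
assert (Hrad : Rbar_lt (Rabs t) (CV_radius a)).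
{ apply Rbar_not_le_lt; intros Hle.
  apply (CV_disk_outside a (Rabs t + 1)).
  - apply (Rbar_le_lt_trans _ (Rabs t) _ Hle); simpl.
    rewrite (Rabs_pos_eq (Rabs t + 1)) by (assert (H := Rabs_pos t); lra); lra.
  - apply ex_series_lim_0; exists (f (Rabs t + 1)); apply Hf. }
rewrite <- (is_pseries_unique (PS_derive a) t l)
  by (apply is_pseries_R; exact Hl).
apply (is_derive_ext (PSeries a) f t _ Hps), is_derive_PSeries, Hrad.
Qed.

Definition amp_re (n : nat) (amp : R -> list bool -> Cx) (t : R) (z : list bool) :=
  if (length z =? 2 * n)%nat then Cre (amp t z) else 0.
Definition amp_im (n : nat) (amp : R -> list bool -> Cx) (t : R) (z : list bool) :=
  if (length z =? 2 * n)%nat then Cim (amp t z) else 0.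

Lemma amp_series (n : nat) (amp : R -> list bool -> Cx) (t : R) (z : list bool) :
  is_evolution n amp ->
  is_series (fun k => Cre (evo_coeff n k z) * t ^ k) (amp_re n amp t z) /\
  is_series (fun k => Cim (evo_coeff n k z) * t ^ k) (amp_im n amp t z).
Proof.
intros Hev; unfold amp_re, amp_im.
destruct (Nat.eqb_spec (length z) (2 * n)) as [Hz|Hz].
- destruct (Hev t z Hz) as [Hre Him].
  apply is_series_Reals in Hre; apply is_series_Reals in Him; split.
  + apply (is_series_eq (fun k => Cre (evo_term n t z k))); [|exact Hre].
    intros k; apply evo_term_coeff; exact Hz.
  + apply (is_series_eq (fun k => Cim (evo_term n t z k))); [|exact Him].
    intros k; apply evo_term_coeff; exact Hz.
- assert (H0 : forall k, evo_coeff n k z = Defs.C0)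
    by (intros k; unfold evo_coeff; destruct (Nat.eqb_spec (length z) (2 * n));
        [contradiction | reflexivity]).
  split; apply (is_series_eq (fun _ => 0)); try apply is_series_zero;
    intros k; rewrite H0; simpl; symmetry; apply Rmult_0_l.
Qed.

(** Differentiate the power series term by term and apply [evo_coeff_S]; [hop] is a finite
    combination and passes through the series. *)
Lemma amp_schroedinger (n : nat) (amp : R -> list bool -> Cx) :
  (0 < n)%nat -> is_evolution n amp ->
  schroedinger (amp_re n amp) (amp_im n amp).
Proof.
intros Hn Hev; split; intros t z.
- apply (power_series_derive (fun k => Cre (evo_coeff n k z))).
  { intros s; apply amp_series; exact Hev. }
  apply (is_series_eq
    (fun k => - hop (fun y => t ^ k * Cim (evo_coeff n k y)) z)).
  { intros k; rewrite hop_scal; destruct (evo_coeff_S n k z Hn) as [-> _]; ring. }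
  apply (is_series_opp (V := R_NormedModule)), is_series_hop; intros y.
  apply (is_series_eq (fun k => Cim (evo_coeff n k y) * t ^ k)).
  { intros k; apply Rmult_comm. }
  apply amp_series; exact Hev.
- apply (power_series_derive (fun k => Cim (evo_coeff n k z))).
  { intros s; apply amp_series; exact Hev. }
  apply (is_series_eq
    (fun k => hop (fun y => t ^ k * Cre (evo_coeff n k y)) z)).
  { intros k; rewrite hop_scal; destruct (evo_coeff_S n k z Hn) as [_ ->]; ring. }
  apply is_series_hop; intros y.
  apply (is_series_eq (fun k => Cre (evo_coeff n k y) * t ^ k)).
  { intros k; apply Rmult_comm. }
  apply amp_series; exact Hev.
Qed.

Lemma amp_support (n : nat) (amp : R -> list bool -> Cx) (t : R) (z : list bool) :
  (0 < n)%nat -> is_evolution n amp -> count_occ Bool.bool_dec z true <> n ->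
  amp_re n amp t z = 0 /\ amp_im n amp t z = 0.
Proof.
intros Hn Hev Hz; destruct (amp_series n amp t z Hev) as [Hre Him].
rewrite <- (is_series_unique _ _ Hre), <- (is_series_unique _ _ Him).
split; apply is_series_unique;
  apply (is_series_eq (fun _ => 0)); try apply is_series_zero; intros k;
  destruct (evo_coeff_support n k z Hn Hz) as [H1 H2];
  rewrite ?H1, ?H2; symmetry; apply Rmult_0_l.
Qed.

Lemma amp_0 (n : nat) (amp : R -> list bool -> Cx) (z : list bool) :
  is_evolution n amp ->
  amp_re n amp 0 z = Cre (evo_coeff n 0 z) /\
  amp_im n amp 0 z = Cim (evo_coeff n 0 z).
Proof.
intros Hev; destruct (amp_series n amp 0 z Hev) as [Hre Him].
apply is_pseries_R, is_pseries_unique in Hre.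
apply is_pseries_R, is_pseries_unique in Him.
rewrite PSeries_0 in Hre, Him; auto.
Qed.

Lemma amp_norm2 (n : nat) (amp : R -> list bool -> Cx) (t : R) :
  (0 < n)%nat -> is_evolution n amp -> 0 <= t ->
  norm2 (2 * n) (amp_re n amp t) (amp_im n amp t) = 1.
Proof.
intros Hn Hev Ht.
transitivity (norm2 (2 * n) (amp_re n amp 0) (amp_im n amp 0)).
- destruct (Rle_lt_or_eq_dec _ _ Ht) as [Hlt|<-]; [|reflexivity].
  symmetry.
  apply (eq_is_derive
    (fun s => norm2 (2 * n) (amp_re n amp s) (amp_im n amp s))); [|exact Hlt].
  intros s _; apply norm2_derive, amp_schroedinger; assumption.
- unfold norm2, inner; rewrite <- strsum_plus.
  rewrite <- (strsum_indicator (2 * n) (init_string n))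
    by (unfold init_string; rewrite length_app, !repeat_length; lia).
  apply strsum_ext; intros z Hz.
  destruct (amp_0 n amp z Hev) as [-> ->]; unfold evo_coeff.
  rewrite Hz, Nat.eqb_refl; simpl; unfold init_state.
  destruct (list_eq_dec bool_dec z (init_string n)); simpl; field.
Qed.

(** * The lower bound and its time average *)

(** With n particles the left side is the mean of (4N-n)/(3n), which is at most 1 as N <= n and at
    most 0 when N <= n/4: it lies below the indicator of the event. *)
Lemma prob_far_ge (n : nat) (amp : R -> list bool -> Cx) (t : R) :
  (0 < n)%nat -> is_evolution n amp -> 0 <= t ->
  1 / 3 - / (6 * INR n) *
    sum_f_R0 (fun j => IZR (side n j) *
      corr_re (2 * n) j j (amp_re n amp t) (amp_im n amp t)) (S (2 * n))
  <= prob_far n amp t.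
Proof.
intros Hn Hev Ht.
assert (Hn' : 0 < INR n) by (apply lt_0_INR; exact Hn).
rewrite current_rate, <- strsum_scal.
replace (1 / 3) with
  (1 / 3 * norm2 (2 * n) (amp_re n amp t) (amp_im n amp t))
  by (rewrite amp_norm2 by assumption; ring).
unfold norm2, inner; rewrite <- strsum_plus, <- strsum_scal.
unfold Rminus at 1; rewrite <- strsum_opp, <- strsum_plus.
apply (strsum_le (2 * n) _ (fun z =>
  if Rlt_dec (INR n / 4) (INR (Ncount n z)) then Cnorm2 (amp t z) else 0)).
intros z Hz.
set (w := amp_re n amp t z * amp_re n amp t z
          + amp_im n amp t z * amp_im n amp t z).
assert (Hw : Cnorm2 (amp t z) = w).
{ unfold w, Cnorm2, amp_re, amp_im; rewrite Hz, Nat.eqb_refl; ring. }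
assert (Hw0 : 0 <= w) by (unfold w; nra).
(* Only strings with exactly n ones carry weight, so under the factor [w] the total count is n. *)
assert (Hsupp : INR (count_occ Bool.bool_dec z true) * w = INR n * w).
{ destruct (Nat.eq_dec (count_occ bool_dec z true) n) as [->|Hne]; [reflexivity|].
  unfold w; destruct (amp_support n amp t z Hn Hev Hne) as [-> ->]; ring. }
replace (1 / 3 * w + - (/ (6 * INR n) *
  ((4 * INR (count_occ bool_dec z true) - 8 * INR (Ncount n z)) * w)))
  with (w * ((4 * INR (Ncount n z) - INR n) / (3 * INR n))).
2: { replace ((4 * INR (count_occ bool_dec z true) - 8 * INR (Ncount n z)) * w)
       with (4 * (INR (count_occ bool_dec z true) * w)
             - 8 * INR (Ncount n z) * w) by ring.
     rewrite Hsupp; field; lra. }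
assert (HN := le_INR _ _ (Ncount_le n z)).
rewrite Hw; destruct (Rlt_dec (INR n / 4) (INR (Ncount n z))) as [Hlt|Hge].
- apply (Rle_trans _ (w * 1)); [|lra]; apply Rmult_le_compat_l; [exact Hw0|].
  apply Rle_div_l; lra.
- rewrite <- (Rmult_0_r w); apply Rmult_le_compat_l; [exact Hw0|].
  apply Rle_div_l; lra.
Qed.

Theorem theorem3 :
  exists c Cst : R, 0 < c /\ 0 < Cst /\
    forall n : nat, (0 < n)%nat -> (exists k : nat, n = (4 * k)%nat) ->
    forall amp : R -> list bool -> Cx, is_evolution n amp ->
    forall pr : Riemann_integrable (prob_far n amp) 0 (c * INR n ^ 3),
      / (c * INR n ^ 3) * RiemannInt pr >= 1 / 4 - Cst / sqrt (INR n).
Proof.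
(* The current varies by at most 64 n^3, and 64/6 < 11. *)
exists 1, 11; split; [lra|]; split; [lra|].
intros n Hn _ amp Hev pr; rewrite <- RInt_Reals; apply Rle_ge.
assert (Hn1 : 1 <= INR n) by (apply (le_INR 1); exact Hn).
set (T := 1 * INR n ^ 3) in *.
assert (HT : 0 < T) by (unfold T; rewrite Rmult_1_l; apply pow_lt; lra).
assert (HS := amp_schroedinger n amp Hn Hev).
set (u := amp_re n amp) in *; set (v := amp_im n amp) in *.
set (rate := fun t => sum_f_R0 (fun j =>
  IZR (side n j) * corr_re (2 * n) j j (u t) (v t)) (S (2 * n))).
(* An antiderivative of the lower bound in [prob_far_ge]. *)
set (F := fun t => 1 / 3 * t - / (6 * INR n) * current n (u t) (v t)).
assert (HF : forall t, is_derive F t (1 / 3 - / (6 * INR n) * rate t)).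
{ intros t; unfold F.
  replace (1 / 3 - / (6 * INR n) * rate t)
    with (1 / 3 * 1 - / (6 * INR n) * rate t) by ring.
  apply (is_derive_minus (V := R_NormedModule)).
  - apply is_derive_scal, @is_derive_id.
  - apply (is_derive_scal (fun s => current n (u s) (v s))).
    apply current_derive; exact HS. }
assert (Hint : is_RInt (fun t => 1 / 3 - / (6 * INR n) * rate t) 0 T (F T - F 0)).
{ apply (is_RInt_derive (V := R_CompleteNormedModule) F); intros t _; [apply HF|].
  apply (ex_derive_continuous (V := R_NormedModule)
    (fun s => 1 / 3 - / (6 * INR n) * rate s)).
  eexists; apply (is_derive_minus (V := R_NormedModule)).
  - apply @is_derive_const.
  - apply is_derive_scal, (is_derive_sum (fun j s =>
      IZR (side n j) * corr_re (2 * n) j j (u s) (v s))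
      (fun j => IZR (side n j)
        * Derive (fun s => corr_re (2 * n) j j (u s) (v s)) t)).
    intros j _.
    apply is_derive_scal, Derive_correct, ex_derive_corr_re; exact HS. }
assert (Hle : F T - F 0 <= RInt (prob_far n amp) 0 T).
{ rewrite <- (is_RInt_unique _ _ _ _ Hint); apply RInt_le.
  - lra.
  - exists (F T - F 0); exact Hint.
  - apply ex_RInt_Reals_1; exact pr.
  - intros t Ht; apply prob_far_ge; trivial; lra. }
assert (Hcur : forall t, 0 <= t -> Rabs (current n (u t) (v t)) <= 32 * INR n ^ 3).
{ intros t Ht; eapply Rle_trans; [apply current_bound, amp_norm2; assumption|].
  (* As n >= 1, 2n+2 is at most 4n. *)
  replace (32 * INR n ^ 3) with (2 * INR n * (4 * INR n) ^ 2) by ring.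
  apply Rmult_le_compat_l; [lra|]; apply pow_incr; lra. }
assert (HcT := Hcur T (Rlt_le _ _ HT)); assert (Hc0 := Hcur 0 (Rle_refl 0)).
apply Rabs_le_between in HcT; apply Rabs_le_between in Hc0.
assert (Hgain : / (6 * INR n) * (current n (u T) (v T) - current n (u 0) (v 0))
                <= 11 * INR n ^ 2).
{ replace (11 * INR n ^ 2) with (/ (6 * INR n) * (66 * INR n ^ 3))
    by (field; lra).
  apply Rmult_le_compat_l; [apply Rlt_le, Rinv_0_lt_compat; lra|].
  assert (0 < INR n ^ 3) by (apply pow_lt; lra); lra. }
apply (Rle_trans _ (/ T * (1 / 3 * T - 11 * INR n ^ 2))).
(* The average is at least 1/3 - 11/n; here 1/3 exceeds 1/4, and 1/n is at most 1/sqrt n. *)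
- replace (/ T * (1 / 3 * T - 11 * INR n ^ 2)) with (1 / 3 - 11 * / INR n)
    by (unfold T; field; lra).
  assert (Hs : 1 <= sqrt (INR n)) by (rewrite <- sqrt_1; apply sqrt_le_1_alt; lra).
  assert (/ INR n <= / sqrt (INR n)).
  { apply Rinv_le_contravar; [lra|].
    rewrite <- (sqrt_sqrt (INR n)) at 2 by lra; nra. }
  unfold Rdiv; lra.
- apply Rmult_le_compat_l; [apply Rlt_le, Rinv_0_lt_compat; exact HT|].
  unfold F in Hle; lra.
Qed.
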